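(* Let $\Delta$ be a simplicial complex and let $\Delta_1,\ldots,\Delta_r$ be the connected components of $\Delta$. Then $$H_{\mathbb{K}[\Delta]}(t)=\sum_{j=1}^rH_{\mathbb{K}[\Delta_j]}(t)-(r-1).$$
   Context: $\mathbb{K}$ is a field. For a simplicial complex $\Delta$ on a finite vertex set $\{x_1,\dots,x_n\}$, the Stanley-Reisner ring is $\mathbb{K}[\Delta]=\mathbb{K}[x_1,\dots,x_n]/I_\Delta$, where $I_\Delta$ is generated by the monomials $x_F=\prod_{x_i\in F}x_i$ with $F\notin\Delta$. $H_{\mathbb{K}[\Delta]}(t)$ denotes its Hilbert series with respect to the standard grading. Each connected component $\Delta_j$ is regarded as a simplicial complex on its own vertex set. *)

(* Defs.v *)
From HB Require Import structures.
From mathcomp Require Import all_boot all_order all_algebra.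
From mathcomp Require Import generic_quotient ring_quotient.
From mathcomp Require Import boolp classical_sets functions.
From mathcomp Require Import mpoly.

Set Implicit Arguments.
Unset Strict Implicit.
Unset Printing Implicit Defensive.

Import GRing.Theory.

Local Open Scope ring_scope.
Local Open Scope quotient_scope.

(* V is the ground set.  A point v of V need not satisfy [set v] \in Delta;
   the vertices of Delta are those that do.  Delta contains the empty face, so
   the void complex is excluded, but the complex {set0} is allowed. *)
Record simplicial_complex (V : finType) := SimplicialComplex {
  faces :> {set {set V}};
  faces0 : finset.set0 \in faces;
  faces_sub : forall F G : {set V}, F \in faces -> G \subset F -> G \in faces
}.

Section Components.
Variables (V : finType) (Delta : simplicial_complex V).

Definition vertices : {set V} := [set v | [set v]%SET \in Delta]%SET.

Definition adjacent : rel V := [rel u v | [set u; v]%SET \in Delta].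

Definition components : {set {set V}} :=
  equivalence_partition (connect adjacent) vertices.

Section Induced.
Variable W : {set V}.
Let T : finType := {v : V | v \in W}.

Definition induced_faces : {set {set T}} :=
  [set F : {set T} | [set val v | v in F]%SET \in Delta]%SET.

Fact induced_faces0 : finset.set0 \in induced_faces.
Proof. by rewrite inE imset0 faces0. Qed.

Fact induced_faces_sub (F G : {set T}) :
  F \in induced_faces -> G \subset F -> G \in induced_faces.
Proof.
rewrite !inE => FD GF; apply: (faces_sub FD); exact: imsetS.
Qed.

(* The faces of Delta contained in W, with W itself as ground set. *)
Definition induced : simplicial_complex T :=
  SimplicialComplex induced_faces0 induced_faces_sub.
End Induced.
End Components.

Section StanleyReisner.
Variables (K : fieldType) (V : finType) (Delta : simplicial_complex V).

Local Notation S := {mpoly K[#|V|]}.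

Definition xvar (v : V) : S := 'X_(enum_rank v).

Definition xmon (F : {set V}) : S := \prod_(v in F) xvar v.

Definition sr_ideal : {pred S} := fun p =>
  `[< exists c : {set V} -> S, p = \sum_(F | F \notin Delta) c F * xmon F >].

Fact sr_ideal_closed : idealr_closed sr_ideal.
Proof.
split.
- apply/asboolP; exists (fun=> 0).
  by rewrite big1 // => F _; rewrite mul0r.
- apply/negP => /asboolP[c] /(congr1 (mpoly.meval (fun=> 0 : K))).
  rewrite meval1 raddf_sum /= big1 => [/eqP|F FD]; first by rewrite oner_eq0.
  rewrite mevalM /xmon rmorph_prod /=.
  have [F0|[v vF]] := set_0Vmem F; first by rewrite F0 faces0 in FD.
  by rewrite (bigD1 v) //= mevalXU mul0r mulr0.
- move=> a p q /asboolP[c ->] /asboolP[c' ->]; apply/asboolP.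
  exists (fun F => a * c F + c' F).
  rewrite mulr_sumr -big_split /=; apply: eq_bigr => F _.
  by rewrite mulrDl mulrA.
Qed.

HB.instance Definition _ := isIdealr.Build S sr_ideal sr_ideal_closed.

Definition sr_ring : Type := {ideal_quot sr_ideal}.
HB.instance Definition _ := GRing.ComNzRing.on sr_ring.

Definition sr_proj (p : S) : sr_ring := \pi_{ideal_quot sr_ideal} p.

Definition sr_scale (a : K) (u : sr_ring) : sr_ring := sr_proj a%:MP * u.

Fact sr_projD p q : sr_proj (p + q) = sr_proj p + sr_proj q.
Proof. exact: rmorphD. Qed.

Fact sr_projM p q : sr_proj (p * q) = sr_proj p * sr_proj q.
Proof. exact: rmorphM. Qed.

Fact sr_scaleA a b u : sr_scale a (sr_scale b u) = sr_scale (a * b) u.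
Proof. by rewrite /sr_scale mpolyCM sr_projM mulrA. Qed.

Fact sr_scale1 : left_id 1 sr_scale.
Proof.
move=> u; rewrite /sr_scale mpolyC1.
have -> : sr_proj 1 = 1 by exact: rmorph1.
by rewrite mul1r.
Qed.

Fact sr_scaleDr : right_distributive sr_scale +%R.
Proof. by move=> a u v; rewrite /sr_scale mulrDr. Qed.

Fact sr_scaleDl u : {morph sr_scale^~ u : a b / a + b}.
Proof. by move=> a b; rewrite /sr_scale mpolyCD sr_projD mulrDl. Qed.

HB.instance Definition _ := GRing.Zmodule_isLmodule.Build K sr_ring
  sr_scaleA sr_scale1 sr_scaleDr sr_scaleDl.

Definition sr_piece (d : nat) : set sr_ring :=
  [set sr_proj p | p in [set p : S | p \is d.-homog]].
End StanleyReisner.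

Section Dimension.
Variables (K : fieldType) (U : lmodType K).

Definition is_basis (W : set U) (k : nat) (b : 'I_k -> U) : Prop :=
  [/\ forall i, W (b i),
      forall c : 'I_k -> K, \sum_i c i *: b i = 0 -> forall i, c i = 0
    & forall u, W u -> exists c : 'I_k -> K, u = \sum_i c i *: b i].

(* Meaningful only when W is a finite-dimensional subspace of U; the value is
   0 when W has no finite basis. *)
Definition dimension (W : set U) : nat :=
  xget 0%N [set k | exists b : 'I_k -> U, is_basis W b].

Lemma is_basis_leq (W : set U) k l (b : 'I_k -> U) (b' : 'I_l -> U) :
  is_basis W b -> is_basis W b' -> (k <= l)%N.
Proof.
move=> [bW bfree _] [_ _ b'gen].
have /choice[c cE] i := b'gen _ (bW i).
pose A := \matrix_(i < k, j < l) c i j.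
suff: row_free A by rewrite /row_free => /eqP <-; exact: rank_leq_col.
rewrite -kermx_eq0; apply/eqP/row_matrixP => i; rewrite row0.
have := mulmx_ker A => /(congr1 (row i)); rewrite row_mul row0.
set r := row i _ => rA; apply/rowP => j; rewrite [RHS]mxE.
apply: (bfree (fun j => r ord0 j)).
under eq_bigr do rewrite cE scaler_sumr.
rewrite exchange_big big1 //= => m _.
under eq_bigr do rewrite scalerA.
rewrite -scaler_suml.
have /rowP/(_ m) := rA; rewrite !mxE => e.
rewrite (_ : \sum_i0 _ = 0) ?scale0r // -[RHS]e.
by apply: eq_bigr => t _; rewrite [A _ _]mxE.
Qed.

Lemma dimension_eq (W : set U) k (b : 'I_k -> U) :
  is_basis W b -> dimension W = k.
Proof.
move=> bP; rewrite /dimension; case: xgetP => [l _ [b' b'P]|]; last first.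
  by move=> /(_ k) []; exists b.
by apply/eqP; rewrite eqn_leq (is_basis_leq b'P bP) (is_basis_leq bP b'P).
Qed.
End Dimension.

(* Formal power series in t, as coefficient sequences.  Only the additive
   structure is declared: 1 and * inherited from functions would be pointwise,
   and the integer constants are given by psC. *)
Definition pseries : Type := nat -> int.
HB.instance Definition _ := GRing.Zmodule.copy pseries (nat -> int).

Definition psC (a : int) : pseries := fun d => if d == 0%N then a else 0.

Definition hilbert_series (K : fieldType) (U : lmodType K)
  (gr : nat -> set U) : pseries := fun d => (dimension (gr d))%:Z.

Definition sr_hilbert (K : fieldType) (V : finType)
  (Delta : simplicial_complex V) : pseries :=
  hilbert_series (@sr_piece K V Delta).

(* Main.v *)
Require Import Defs.
From mathcomp Require Import all_boot all_order all_algebra.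
From mathcomp Require Import ring_quotient boolp mpoly.

Set Implicit Arguments.
Unset Strict Implicit.
Unset Printing Implicit Defensive.

Import GRing.Theory.
Local Open Scope ring_scope.

(** The Stanley-Reisner ideal is a monomial ideal: a polynomial lies in it
    exactly when the support of each of its monomials is a non-face
    ([sr_idealP]).  Hence the monomials whose support is a face map to a basis
    of the quotient, and the Hilbert function in degree d counts the monomials
    of degree d supported on a face ([dimension_sr_piece]).

    A monomial of positive degree has a nonempty support.  If the support is a
    face, its vertices are pairwise adjacent, so it lies in exactly one
    connected component W ([face_sub_component]), and the monomial is counted
    once, in the Hilbert function of the complex induced on W.  The Hilbert
    functions of the components therefore add up to that of the whole complex
    in every positive degree ([card_face_exponents_components]).  In degree 0
    the only monomial is 1, which each of the r components counts once, so the
    sum exceeds the true value by r - 1; when r = 0 this excess is -1. *)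

(** * Monomial description of the Stanley-Reisner ideal *)

Section MonomialIdeal.
Variables (K : fieldType) (V : finType) (Delta : simplicial_complex V).

Definition mnm_support (m : 'X_{1..#|V|}) : {set V} :=
  [set v | m (enum_rank v) != 0%N].

Definition mnm_of_set (F : {set V}) : 'X_{1..#|V|} :=
  (\sum_(v in F) U_(enum_rank v))%MM.

Lemma mnm_of_setE (F : {set V}) v : mnm_of_set F (enum_rank v) = (v \in F).
Proof.
rewrite /mnm_of_set mnm_sumE; under eq_bigr do
  rewrite mnm1E (inj_eq enum_rank_inj).
have [vF|vF] := boolP (v \in F).
  by rewrite (bigD1 v) //= eqxx big1 // => u /andP[_ /negbTE->].
by rewrite big1 // => u uF; case: eqP => // uv; rewrite -uv uF in vF.
Qed.

Lemma xmonE (F : {set V}) : xmon K F = 'X_[mnm_of_set F].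
Proof. exact: mprodXE. Qed.

(** The ideal has a generator for every non-face, in particular for the support
    of m itself, and the squarefree monomial on that support divides m. *)
Lemma mpolyX_sr_ideal (m : 'X_{1..#|V|}) :
  mnm_support m \notin Delta -> 'X_[K, m] \in sr_ideal Delta.
Proof.
move=> mD; set F := mnm_support m in mD.
have leFm : (mnm_of_set F <= m)%MM.
  apply/mnm_lepP => i; rewrite -(enum_valK i) mnm_of_setE inE.
  by case: (m _).
apply/asboolP; exists (fun G => if G == F then 'X_[m - mnm_of_set F] else 0).
rewrite (bigD1 F) //= eqxx big1 => [|G /andP[_ /negbTE->]]; last first.
  by rewrite mul0r.
by rewrite addr0 xmonE -mpolyXD submK.
Qed.

(** Every monomial of a multiple of [xmon K F] has a support containing F, and
    the faces are closed under subsets, so no such monomial is supported on a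
    face. *)
Lemma sr_idealP (p : {mpoly K[#|V|]}) :
  reflect {in msupp p, forall m, mnm_support m \notin Delta}
          (p \in sr_ideal Delta).
Proof.
apply: (iffP idP) => [/asboolP[c ->] m|pN]; last first.
  rewrite (mpolyE p) big_seq; apply: rpred_sum => m mp.
  by rewrite -mul_mpolyC; apply/idealMr/mpolyX_sr_ideal/pN.
rewrite mcoeff_msupp raddf_sum /=; apply: contraNN => mD.
rewrite big1 // => F FD; apply/eqP; rewrite mcoeff_eq0.
apply: contraNN FD; rewrite xmonE (perm_mem (msuppMX _ _)) => /mapP[k _ mE].
apply: (faces_sub mD); apply/subsetP => v vF.
by rewrite inE mE mnmDE mnm_of_setE vF.
Qed.

Lemma sr_proj_eq (p q : {mpoly K[#|V|]}) :
  (sr_proj Delta p == sr_proj Delta q) = (p - q \in sr_ideal Delta).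
Proof. by rewrite Quotient.idealrBE. Qed.

Lemma sr_proj_lin (I : Type) (r : seq I) (P : pred I) (c : I -> K)
    (F : I -> {mpoly K[#|V|]}) :
  sr_proj Delta (\sum_(i <- r | P i) c i *: F i) =
  \sum_(i <- r | P i) c i *: sr_proj Delta (F i).
Proof.
rewrite /sr_proj rmorph_sum; apply: eq_bigr => i _.
by rewrite -mul_mpolyC rmorphM.
Qed.
End MonomialIdeal.

(** * Dimension of the graded pieces *)

Section FaceExponents.
Variables (V : finType) (Delta : simplicial_complex V) (d : nat).

(** Exponents of a monomial of degree d are at most d; bounding them makes the
    exponent functions a finite type, whose subsets can be counted.  Indexing
    them by V instead of ['I_#|V|] lets a change of ground set be a mere
    restriction or extension of functions. *)
Definition exp_support (f : {ffun V -> 'I_d.+1}) : {set V} :=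
  [set v | f v != 0%N :> nat].

Definition face_exponents : {set {ffun V -> 'I_d.+1}} :=
  [set f | (exp_support f \in Delta) && (\sum_v f v == d)%N].

Definition mnm_of_exp (f : {ffun V -> 'I_d.+1}) : 'X_{1..#|V|} :=
  [multinom f (enum_val i) : nat | i < #|V|].

Lemma mnm_of_expE f v : mnm_of_exp f (enum_rank v) = f v.
Proof. by rewrite mnmE enum_rankK. Qed.

Lemma mnm_of_exp_inj : injective mnm_of_exp.
Proof.
by move=> f g fg; apply/ffunP => v; apply: val_inj; rewrite /= -!mnm_of_expE fg.
Qed.

Lemma mnm_support_exp f : mnm_support (mnm_of_exp f) = exp_support f.
Proof. by apply/setP => v; rewrite !inE mnm_of_expE. Qed.

Lemma mdeg_mnm_of_exp f : mdeg (mnm_of_exp f) = (\sum_v f v)%N.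
Proof.
rewrite mdegE (reindex (@enum_rank V)) /=; last first.
  by apply: onW_bij; exact: enum_rank_bij.
by apply: eq_bigr => v _; rewrite mnm_of_expE.
Qed.

Lemma mnm_of_exp_onto (m : 'X_{1..#|V|}) :
  mdeg m = d -> exists f, m = mnm_of_exp f.
Proof.
move=> md; exists [ffun v => inord (m (enum_rank v))].
apply/mnmP => i; rewrite mnmE ffunE enum_valK inordK // ltnS -md mdegE.
by rewrite (bigD1 i) //= leq_addr.
Qed.

(** The face monomials are independent modulo the ideal because a combination
    of them in the ideal has no monomial left.  They span because subtracting
    from p its part on the face monomials leaves only non-face monomials. *)
Lemma dimension_sr_piece (K : fieldType) :
  dimension (@sr_piece K V Delta d) = #|face_exponents|.
Proof.
pose X (i : 'I_#|face_exponents|) : {mpoly K[#|V|]} :=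
  'X_[mnm_of_exp (enum_val i : {ffun V -> 'I_d.+1})].
pose b (i : 'I_#|face_exponents|) := sr_proj Delta (X i).
suff : is_basis (@sr_piece K V Delta d) b by exact: dimension_eq.
have projE c : sr_proj Delta (\sum_i c i *: X i) = \sum_i c i *: b i.
  exact: sr_proj_lin.
have exp_in (i : 'I_#|face_exponents|) := enum_valP i.
split=> [i|c|_ [p /= /dhomogP pd <-]].
- exists (X i) => //=; rewrite dhomogX /= mdeg_mnm_of_exp.
  by move: (exp_in i); rewrite inE => /andP[].
- move=> c0 i.
  have /eqP : sr_proj Delta (\sum_i c i *: X i) = sr_proj Delta 0.
    by apply: etrans (projE c) (etrans c0 _); apply/esym; exact: rmorph0.
  rewrite sr_proj_eq subr0 => /sr_idealP cX.
  apply/eqP; rewrite -[c i == 0]negbK; apply/negP => ci.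
  have /cX : mnm_of_exp (enum_val i) \in msupp (\sum_i c i *: X i).
    rewrite mcoeff_msupp raddf_sum (bigD1 i) //= big1 => [|j ji].
      by rewrite addr0 mcoeffZ mcoeffX eqxx mulr1.
    rewrite mcoeffZ mcoeffX (inj_eq mnm_of_exp_inj) (inj_eq enum_val_inj).
    by rewrite (negbTE ji) mulr0.
  by rewrite mnm_support_exp; move: (exp_in i); rewrite inE => /andP[->].
- exists (fun i => p@_(mnm_of_exp (enum_val i))).
  apply: etrans (projE _); apply/eqP; rewrite sr_proj_eq; apply/sr_idealP => m.
  set q := p - _ => mq.
  (* homogeneity puts m in the range of [mnm_of_exp], whose exponents are
     bounded by d *)
  have /dhomogP/(_ _ mq) md : q \is d.-homog.
    apply: rpredB; first exact/dhomogP.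
    apply: rpred_sum => i _; apply: rpredZ; rewrite dhomogX /= mdeg_mnm_of_exp.
    by move: (exp_in i); rewrite inE => /andP[].
  have [f mE] := mnm_of_exp_onto md.
  apply: contraTN mq; rewrite mcoeff_msupp negbK mE mnm_support_exp => fD.
  have fI : f \in face_exponents by rewrite inE fD -mdeg_mnm_of_exp -mE md /=.
  have [j fj] : exists j : 'I_#|face_exponents|, f = enum_val j.
    by exists (enum_rank_in fI f); rewrite enum_rankK_in.
  rewrite mcoeffB raddf_sum (bigD1 j) //= big1 => [|i ij];
    rewrite mcoeffZ mcoeffX (inj_eq mnm_of_exp_inj) fj (inj_eq enum_val_inj).
    by rewrite eqxx mulr1 addr0 subrr.
  by rewrite (negbTE ij) mulr0.
Qed.

End FaceExponents.

(** * Faces and connected components *)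

Section Components.
Variables (V : finType) (Delta : simplicial_complex V).

Lemma adjacent_sym : ssrbool.symmetric (adjacent Delta).
Proof. by move=> u v; rewrite /adjacent /= finset.setUC. Qed.

Lemma connect_adjacent_equiv :
  {in vertices Delta & &, equivalence_rel (connect (adjacent Delta))}.
Proof.
move=> u v w _ _ _; split=> [|uv]; first exact: connect0.
exact: (same_connect (sym_connect_sym adjacent_sym) uv).
Qed.

(** Two vertices of a face span a face, so a face never meets two components. *)
Lemma face_sub_component (F W : {set V}) v :
  F \in faces Delta -> v \in F -> W \in components Delta ->
  (F \subset W) = (W == pblock (components Delta) v).
Proof.
move=> FD vF WC; have eqR := connect_adjacent_equiv.
have /and3P[_ tI _] := equivalence_partitionP eqR.
apply/subsetP/eqP => [FW|-> u uF]; first by rewrite (def_pblock tI WC (FW _ vF)).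
have vert w : w \in F -> w \in vertices Delta.
  by move=> wF; rewrite inE (faces_sub FD) // sub1set.
rewrite /components pblock_equivalence_partition ?vert //; apply: connect1.
by apply: (faces_sub FD); apply/subsetP => w; rewrite !inE => /orP[]/eqP->.
Qed.

Variable (d : nat).

Definition extend_exp (W : {set V}) (g : {ffun {v | v \in W} -> 'I_d.+1}) :
  {ffun V -> 'I_d.+1} := [ffun v => oapp g ord0 (insub v)].

Lemma extend_exp_val (W : {set V}) (g : {ffun {v | v \in W} -> 'I_d.+1}) w :
  extend_exp g (val w) = g w.
Proof. by rewrite ffunE valK. Qed.

Lemma extend_exp_out (W : {set V}) (g : {ffun {v | v \in W} -> 'I_d.+1}) v :
  v \notin W -> extend_exp g v = ord0.
Proof. by move=> vW; rewrite ffunE insubN. Qed.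

Lemma exp_support_extend (W : {set V}) (g : {ffun {v | v \in W} -> 'I_d.+1}) :
  exp_support (extend_exp g) = [set val w | w in exp_support g].
Proof.
apply/setP => v; rewrite inE; have [vW|vW] := boolP (v \in W).
  by rewrite -[v]/(val (Sub v vW : {v | v \in W})) extend_exp_val
             (mem_imset _ _ val_inj) inE.
rewrite extend_exp_out // eqxx; apply/esym/negP => /imsetP[w _ vw].
by rewrite vw (valP w) in vW.
Qed.

(** Extension by zero is a bijection onto the exponent functions supported in
    W; it preserves the degree and maps the support to its image in V, so it
    also preserves the face condition. *)
Lemma card_face_exponents_induced (W : {set V}) :
  #|face_exponents (induced Delta W) d| =
  #|[set f in face_exponents Delta d | exp_support f \subset W]|.
Proof.
have ext_inj : injective (@extend_exp W).
  by move=> f g fg; apply/ffunP => w; rewrite -!extend_exp_val fg.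
rewrite -(card_imset _ ext_inj); congr #|pred_of_set _|.
have sumE g : (\sum_v extend_exp g v = \sum_(w : {v | v \in W}) g w)%N.
  rewrite (bigID (mem W)) /= [X in (_ + X)%N]big1 => [|v vW]; last first.
    by rewrite extend_exp_out.
  rewrite addn0 big_sub /=.
  by apply: eq_bigr => w _; rewrite extend_exp_val.
apply/setP => f; rewrite [RHS]inE; apply/imsetP/andP => [[g gD ->]|[fD fW]].
  move: gD; rewrite !inE sumE exp_support_extend => /andP[-> ->]; split=> //.
  by apply/subsetP => _ /imsetP[w _ ->]; exact: valP.
pose g := [ffun w : {v | v \in W} => f (val w)].
have fE : f = extend_exp g.
  apply/ffunP => v; have [vW|vW] := boolP (v \in W).
    by rewrite -[v]/(val (Sub v vW : {v | v \in W})) extend_exp_val ffunE.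
  rewrite extend_exp_out //; apply: val_inj; apply/eqP.
  by apply: contraNT vW => fv; apply: (subsetP fW); rewrite inE.
exists g => //.
by move: fD; rewrite fE !inE exp_support_extend sumE.
Qed.

(** Double counting of the pairs (f, W) with the support of f inside W.  The
    positive degree gives the support a vertex v, and the component of v is
    the only possible W. *)
Lemma card_face_exponents_components : (0 < d)%N ->
  #|face_exponents Delta d| =
  (\sum_(W in components Delta) #|face_exponents (induced Delta W) d|)%N.
Proof.
move=> d0; under eq_bigr do rewrite card_face_exponents_induced -sum1dep_card.
rewrite -sum1_card (exchange_big_dep (mem (face_exponents Delta d))) /=;
  last by move=> W f _ /andP[].
apply: eq_bigr => f fD; have := fD; rewrite inE => /andP[fF /eqP fd].
have [v vf] : exists v, v \in exp_support f.
  apply/set0Pn; apply: contraTneq d0 => f0.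
  rewrite -leqNgt -fd leqn0 sum_nat_eq0.
  by apply/forallP => v; have /setP/(_ v) := f0; rewrite !inE => /negbFE.
rewrite (big_pred1 (pblock (components Delta) v)) // => W /=.
rewrite fF fd eqxx /=.
have [WC|WC] := boolP (W \in components Delta).
  by rewrite (face_sub_component fF vf WC).
apply/esym/negP => /eqP WE; case/negP: WC; rewrite WE pblock_mem //.
have /and3P[/eqP cov _ _] := equivalence_partitionP connect_adjacent_equiv.
by rewrite /components cov inE (faces_sub fF) // sub1set.
Qed.
End Components.

Lemma card_face_exponents0 (V : finType) (Delta : simplicial_complex V) :
  #|face_exponents Delta 0| = 1%N.
Proof.
rewrite (_ : face_exponents _ _ = [set [ffun=> ord0]]) ?cards1 //.
apply/setP => f; have -> : f = [ffun=> ord0].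
  by apply/ffunP => v; rewrite ffunE; exact: ord1.
rewrite !inE eqxx; apply/andP; split.
  rewrite (_ : exp_support _ = finset.set0) ?faces0 //.
  by apply/setP => v; rewrite !inE ffunE.
by rewrite big1 // => v _; rewrite ffunE.
Qed.

Theorem proposition1p5 (K : fieldType) (V : finType)
    (Delta : simplicial_complex V) :
  sr_hilbert K Delta =
    \sum_(W in components Delta) sr_hilbert K (induced Delta W)
    - psC ((#|components Delta|)%:Z - 1).
Proof.
apply/funext => d.
have -> : sr_hilbert K Delta d = (#|face_exponents Delta d|)%:Z.
  by rewrite -(dimension_sr_piece Delta d K).
have evalD : {morph (fun a : pseries => a d) : a b / a + b >-> a + b} by [].
have -> : forall a b : pseries, (a - b) d = a d - b d by [].
rewrite (big_morph (fun a : pseries => a d) evalD (erefl _)).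
under eq_bigr do rewrite /sr_hilbert /hilbert_series dimension_sr_piece.
rewrite /psC; case: d {evalD} => [|d] /=.
  under eq_bigr do rewrite card_face_exponents0.
  by rewrite card_face_exponents0 sumr_const natz opprB addrC subrK.
rewrite subr0 card_face_exponents_components //.
by rewrite (big_morph Posz PoszD (erefl _)).
Qed.
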